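(* Let $\Omega=(a,b)$ with real numbers $a<b$. For all grid sizes $h$ and each $p\in\mathbb{N}$, there is a non-constant function $u\in H^1(\Omega)$ such that $$\inf_{u_{p,h}\in\widetilde{S}_{p,h}(\Omega)}\|u-u_{p,h}\|_{L^2(\Omega)}\ge\frac{1}{4\sqrt{3}}\,h\,|u|_{H^1(\Omega)}.$$
   Context: $\mathbb{N}=\{1,2,3,\ldots\}$, $\mathbb{N}_0=\mathbb{N}\cup\{0\}$. A grid size for $\Omega=(a,b)$ is a real $h>0$ such that $n_h:=h^{-1}(b-a)\in\mathbb{N}$. $H^r(\Omega)$ is the standard Sobolev space ($H^0=L^2$) and $|u|_{H^r(\Omega)}:=\|\frac{\partial^r}{\partial x^r}u\|_{L^2(\Omega)}$. $\mathbb{P}^p$ is the space of polynomials of degree at most $p$, and $$S_{p,h}(\Omega):=\{u\in H^p(\Omega): u|_{(a+hj,a+h(j+1)]}\in\mathbb{P}^p\text{ for all }j=0,\ldots,n_h-1\}.$$ The space of splines with vanishing odd derivatives, $\widetilde{S}_{p,h}(\Omega)$, is the space of all $u_{p,h}\in S_{p,h}(\Omega)$ satisfying $$\frac{\partial^{2l+1}}{\partial x^{2l+1}}u_{p,h}(a)=\frac{\partial^{2l+1}}{\partial x^{2l+1}}u_{p,h}(b)=0\quad\text{for all }l\in\mathbb{N}_0\text{ with }2l+1<p.$$ *)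

(* Defs.v *)
From mathcomp Require Import all_boot all_order all_algebra.
From mathcomp Require Import all_classical all_reals all_analysis.

Set Implicit Arguments.
Unset Strict Implicit.
Unset Printing Implicit Defensive.

Import Order.TTheory GRing.Theory Num.Theory.
Import numFieldNormedType.Exports.

Local Open Scope classical_set_scope.
Local Open Scope ring_scope.

Section SobolevSpline.
Context {R : realType}.
Implicit Types (a b h x : R) (u v phi : R -> R) (r p j k l : nat).

Local Notation mu := (@lebesgue_measure R).

(* Functions on ]a, b[ are represented by total functions R -> R; nothing
   below depends on their values outside ]a, b]. *)

Definition L2_norm a b u : \bar R :=
  'N[mu]_(2%:E)[EFin \o (u \_ `]a, b[)]%E.

Definition in_L2 a b u : Prop := (u \_ `]a, b[) \in Lfun mu 2%:E.

(* phi is in C_c^oo(]a, b[) *)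
Definition test_function a b phi : Prop :=
  [/\ forall k x, derivable (phi^`(k))%classic x 1,
      compact (closure [set x | phi x != 0]) &
      closure [set x | phi x != 0] `<=` `]a, b[].

Definition is_weak_derivative a b r u v : Prop :=
  [/\ locally_integrable `]a, b[ u,
      locally_integrable `]a, b[ v &
      forall phi, test_function a b phi ->
        \int[mu]_(x in `]a, b[) (u x * (phi^`(r))%classic x) =
        (-1) ^+ r * \int[mu]_(x in `]a, b[) (v x * phi x)].

(* Weak derivatives are unique up to null sets; weak_derivative selects one
   (and is an arbitrary function if there is none). *)
Definition weak_derivative a b r u : R -> R :=
  get [set v | is_weak_derivative a b r u v].

Definition in_H a b r u : Prop :=
  in_L2 a b u /\
  forall k, (k <= r)%N ->
    exists2 v, is_weak_derivative a b k u v & in_L2 a b v.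

Definition H_seminorm a b r u : \bar R := L2_norm a b (weak_derivative a b r u).

(* Elements of H^1 are classes modulo null sets, hence "constant almost
   everywhere". *)
Definition ae_constant a b u : Prop :=
  exists c : R, {ae mu, forall x, x \in `]a, b[ -> u x = c}.

Definition grid_size a b h : Prop :=
  0 < h /\ exists2 n : nat, (0 < n)%N & h^-1 * (b - a) = n%:R.

(* j < n_h = h^-1 (b - a) is expressed in R. *)
Definition spline a b p h u : Prop :=
  in_H a b p u /\
  forall j, j%:R < h^-1 * (b - a) ->
    exists2 q : {poly R}, (size q <= p.+1)%N &
      forall x, x \in `]a + h * j%:R, a + h * j.+1%:R] -> u x = q.[x].

(* A spline is polynomial near each end of ]a, b[, and its derivatives at a and
   b are the one-sided limits of the derivatives inside ]a, b[. *)
Definition reduced_spline a b p h u : Prop :=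
  spline a b p h u /\
  forall l, (l.*2.+1 < p)%N ->
    (u^`(l.*2.+1))%classic x @[x --> a^'+] --> (0 : R) /\
    (u^`(l.*2.+1))%classic x @[x --> b^'-] --> (0 : R).

End SobolevSpline.

(* Main.v *)
(** The P1 splines on the grid of size h/2 form a space of dimension 2n+1, where
    n = (b-a)/h, whereas a reduced spline is determined by its n piecewise
    constant p-th derivatives and its value at a, so that these splines span at
    most n+1 dimensions. Hence some nonzero P1 spline u is L2-orthogonal to all
    reduced splines, and its distance to them is ||u||. On each cell of length
    h/2 an affine function of slope e satisfies
    ||u||^2 >= (h/2)^2/12 * ||e||^2, which gives ||u|| >= h/(4 sqrt 3) |u|_{H^1}.
    Membership in H^p forces the polynomial pieces to match up to order p-1 at
    the nodes: a jump of the k-th derivative would make the weak derivative of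
    order k+1 a Dirac mass, contradicting local integrability. *)
Require Import Defs.
From HB Require Import structures.
From mathcomp Require Import all_boot all_order all_algebra.
From mathcomp Require Import all_classical all_reals all_analysis.
From mathcomp Require Import measurable_realfun.
From mathcomp Require Import zify ring lra.

Import Order.TTheory GRing.Theory Num.Theory.
Import numFieldNormedType.Exports.

Set Implicit Arguments.
Unset Strict Implicit.
Unset Printing Implicit Defensive.

Local Open Scope classical_set_scope.
Local Open Scope ring_scope.

(** * Linear algebra *)

(** Halving the grid is what makes the count strict: continuous P1 functions on the grid of size h
    itself have only n+1 dimensions, no more than the bound for the reduced splines. Non-constancy
    of u comes for free: constants are reduced splines, and a nonzero constant is not orthogonal to
    them. The factor 1/12 is that of an affine function of mean zero. The obstacle is that a spline
    is only assumed to have weak derivatives, whereas the count needs pointwise matching of its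
    polynomial pieces. The bridge is the du Bois-Reymond lemma, for which explicit test functions
    are built. Afterwards a reduced spline is handled as the finite family of its pieces. Such
    families live in an infinite-dimensional module, so the count is phrased with a linear map that
    is injective on a subspace, the latter being a mere predicate. *)

Lemma exists_orthogonal (F : fieldType) (W : lmodType F) (P : W -> Prop)
    (m n : nat) (Phi : {linear W -> 'rV[F]_m}) (B : {linear W -> 'rV[F]_n}) :
    (m < n)%N -> P 0 -> (forall k x y, P x -> P y -> P (k *: x + y)) ->
    (forall w, P w -> Phi w = 0 -> w = 0) ->
  exists2 c : 'cV[F]_n, c != 0 & forall w, P w -> B w *m c = 0.
Proof.
(* Otherwise the values of [B] on [P] span the whole n-dimensional space: greedily chosen elements
   of [P] have independent images under [B]. Being n > m in number, they have dependent images under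
   [Phi], and injectivity of [Phi] on [P] carries the dependency over to [B]. *)
move=> mn P0 PD Phi_inj; apply: contrapT => noc.
have rankB (k : nat) : (k <= n)%N -> exists2 w : 'I_k -> W,
    forall i, P (w i) & \rank (\matrix_i B (w i)) = k.
  elim: k => [_|k IH kn].
    by exists (fun=> 0) => //; apply/eqP; rewrite -leqn0 rank_leq_row.
  have [w Pw rw] := IH (ltnW kn); set M := \matrix_i B (w i) in rw.
  (* A nonzero column of the cokernel is a functional that vanishes on the rows found so far. By
     [noc] some element of [P] is not annihilated by it, and its image raises the rank. *)
  have [j cj0] : exists j, col j (cokermx M) != 0.
    apply: contrapT => cj; have : \rank (cokermx M) = 0%N.
      apply/eqP; rewrite mxrank_eq0; apply/eqP/matrixP => i j; rewrite mxE.
      have /negP := (forallNP _).2 cj j; rewrite negbK => /eqP /matrixP /(_ i 0).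
      by rewrite !mxE.
    by rewrite mxrank_coker rw => /eqP; rewrite subn_eq0 leqNgt kn.
  have [v [Pv Bv]] : exists v, P v /\ B v *m col j (cokermx M) != 0.
    apply: contrapT => nv; apply: noc; exists (col j (cokermx M)) => // v Pv.
    by apply/eqP/negPn/negP => Bv; apply: nv; exists v.
  exists (fun i => if unlift ord_max i is Some i' then w i' else v).
    by move=> i; case: unliftP.
  set M' := \matrix_i _.
  have MM' : (M <= M')%MS.
    apply/row_subP => i; rewrite (_ : row i M = row (lift ord_max i) M') ?row_sub//.
    by rewrite !rowK liftK.
  have : (M < M')%MS.
    rewrite ltmxE MM'/=; apply/negP => M'M; move: Bv.
    have : (row ord_max M' <= M)%MS by exact: submx_trans (row_sub _ _) M'M.
    rewrite rowK unlift_none => /submxP[D ->].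
    by rewrite colE -mulmxA [M *m _]mulmxA mulmx_coker mul0mx mulmx0 eqxx.
  by move=> /rank_ltmx; rewrite rw => lt; apply/eqP; rewrite eqn_leq rank_leq_row.
have [w Pw rw] := rankB n (leqnn n).
pose K := kermx (\matrix_i Phi (w i)).
have [i Ki0] : exists i, row i K != 0.
  apply: contrapT => Ki; have : \rank K = 0%N.
    apply/eqP; rewrite mxrank_eq0; apply/eqP/row_matrixP => i.
    by have /negP := (forallNP _).2 Ki i; rewrite negbK row0 => /eqP.
  by rewrite mxrank_ker => /eqP; rewrite subn_eq0 leqNgt (leq_ltn_trans (rank_leq_col _)).
set x := row i K in Ki0.
pose v := \sum_j x 0 j *: w j.
have comb p (L : {linear W -> 'rV[F]_p}) : L v = x *m \matrix_j L (w j).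
  rewrite linear_sum mulmx_sum_row; apply: eq_bigr => j _.
  by rewrite linearZ rowK.
have Pv : P v.
  rewrite /v; elim/big_rec: _ => // j y _ Py; exact: PD.
have v0 : v = 0.
  by apply: Phi_inj => //; rewrite comb; apply/sub_kermxP; exact: row_sub.
move: (comb _ B); rewrite v0 linear0 => /esym xB.
have : row_free (\matrix_j B (w j)) by rewrite /row_free rw.
by move=> rf; move: Ki0; rewrite -(mulmx_free_eq0 _ rf) xB eqxx.
Qed.

Section polynomial_pieces.
Context {R : realFieldType}.
Implicit Types (q : {poly R}) (t a b : R) (p : nat).

(** Taylor expansion at [t] makes q vanish at every point, hence at more points than its degree
    allows. *)
Lemma poly_eq0_derivn q t p : (size q <= p)%N ->
  (forall k, (k < p)%N -> q^`(k).[t] = 0) -> q = 0.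
Proof.
move=> qp q0.
have q0x x : q.[x] = 0.
  rewrite -(subrK t x) addrC nderiv_taylor; last exact: mulrC.
  rewrite big1// => i _; have := q0 i (leq_trans (ltn_ord i) qp).
  rewrite nderivn_def hornerMn => /eqP; rewrite mulrn_eq0.
  by rewrite eqn0Ngt fact_gt0/= => /eqP ->; rewrite mul0r.
apply/eqP/negPn/negP => q_neq0.
have := max_poly_roots q_neq0 (rs := [seq i%:R | i <- iota 0 (size q)]).
rewrite size_map size_iota ltnn => h; apply: notF; apply: h.
  by apply/allP => x _; rewrite /root q0x.
by rewrite map_inj_uniq ?iota_uniq// => i j /eqP; rewrite eqr_nat => /eqP.
Qed.

Lemma size_poly_le1_odd_derivn q a b p : a != b -> (size q <= p)%N ->
  (forall l, (l.*2.+1 < p)%N ->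
     q^`(l.*2.+1).[a] = 0 /\ q^`(l.*2.+1).[b] = 0) ->
  (size q <= 1)%N.
Proof.
move=> ab qp odd0; rewrite leqNgt; apply/negP => q1.
(* Whichever of the derivatives of order [d] and [d - 1] is the odd one, its
   vanishing at [a] and [b] kills the leading coefficient. *)
pose d := (size q).-1.
have q_neq0 : q != 0 by rewrite -size_poly_gt0 (ltn_trans _ q1).
have dp : (d < p)%N by rewrite /d prednK ?size_poly_gt0.
have qd : q^`(d) != 0.
  apply/negP => /eqP/(congr1 (fun r : {poly R} => r`_0)).
  rewrite coef_derivn coef0 addn0 ffactnn => /eqP.
  by rewrite mulrn_eq0 eqn0Ngt fact_gt0 -lead_coefE lead_coef_eq0/= (negbTE q_neq0).
have d0 : (0 < d)%N by rewrite /d -subn1 subn_gt0.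
have size_derivn k : (size q^`(k) <= size q - k)%N.
  elim: k => [|k IH]; first by rewrite subn0.
  rewrite derivnS; have [->|qk] := eqVneq q^`(k) 0; first by rewrite deriv0 size_poly0.
  by have := lt_size_deriv qk; lia.
have [od|ed] := boolP (odd d).
  have dE : d = d./2.*2.+1 by rewrite -[LHS]odd_double_half od.
  have := (odd0 d./2); rewrite -dE => /(_ dp)[+ _].
  have /size1_polyC qdE : (size q^`(d) <= 1)%N.
    by rewrite (leq_trans (size_derivn _))// /d; lia.
  by rewrite qdE hornerC => q0; move: qd; rewrite qdE q0 polyC0 eqxx.
have dE : d.-1 = d./2.-1.*2.+1.
  have := odd_double_half d; rewrite (negbTE ed); lia.
have := (odd0 d./2.-1); rewrite -dE => /(_ (leq_ltn_trans (leq_pred _) dp))[qa qb].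
suff qd1 : q^`(d.-1) = 0.
  by move: qd; rewrite -(prednK d0) derivnS qd1 deriv0 eqxx.
apply/eqP/negPn/negP => qd1.
have := max_poly_roots qd1 (rs := [:: a; b]).
rewrite /= /root qa qb eqxx/= inE ab/= => /(_ isT isT).
move=> /leq_trans/(_ (size_derivn _)); rewrite /d; clear -q1.
by case: (size q) q1 => [|[|k]] // _;
  rewrite [k.+2.-1.-1]/= !subSn ?leqnSn ?leqnn ?subnn ?(leq_trans (leqnSn k)).
Qed.
End polynomial_pieces.

(** * Smooth bump functions *)

Section smooth_bump.
Context {R : realType}.
Implicit Types (l x c d : R) (P Q : {poly R}).

(** Differentiating exp(-l/x) produces polynomials in 1/x; the factor [P] evaluated at 1/x makes the
    family closed under derivation. The rate [l] stays free so that it can tend to 0 later. *)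
Definition flat_exp l P x := if 0 < x then P.[x^-1] * expR (- l * x^-1) else 0.

(** The exponential series bounds each monomial: y^i <= i! l^(-i) exp(l y). *)
Lemma horner_expR_bounded l P : 0 < l ->
  exists C : R, forall y, 0 < y -> `|P.[y] * expR (- l * y)| <= C.
Proof.
move=> l0; exists (\sum_(i < size P) `|P`_i| * (i`!%:R / l ^+ i)) => y y0.
rewrite horner_coef mulr_suml (le_trans (ler_norm_sum _ _ _))// ler_sum// => i _.
have y_ge0 := ltW y0.
rewrite -mulrA normrM ler_wpM2l// ger0_norm ?mulr_ge0 ?exprn_ge0 ?expR_ge0//.
rewrite mulNr expRN ler_pdivrMr ?expR_gt0//.
rewrite mulrAC ler_pdivlMr ?exprn_gt0//.
rewrite -exprMn [l * y]mulrC -ler_pdivrMl ?ltr0n ?fact_gt0//.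
case: (nat_of_ord i) => [|n].
  by rewrite expr0 invr1 mulr1 -[X in X <= _]expR0 ler_expR mulr_ge0// ltW.
rewrite [X in X <= _]mulrC (le_trans _ (expR_ge1Dxn n (mulr_ge0 y_ge0 (ltW l0))))//.
by rewrite lerDr.
Qed.

Lemma is_derive_flat_exp l P x : 0 < l ->
  is_derive x 1 (flat_exp l P) (flat_exp l ('X^2 * (l *: P - P^`())) x).
Proof.
move=> l0; have [x0|x0|->] := ltgtP x 0.
- rewrite {2}/flat_exp ltNge (ltW x0)/=.
  apply: (@near_eq_is_derive _ _ _ (cst 0)).
  by near=> y; rewrite /flat_exp ltNge ltW//=; near: y; exact: lt_nbhsl.
- have x_neq0 : id x != 0 :> R by rewrite gt_eqF.
  have dinv := is_deriveV x_neq0 (is_derive_id x 1).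
  have dP := is_derive1_comp (is_derive_poly P x^-1) dinv.
  have dl := is_deriveZ (- l) dinv.
  have de := @is_derive1_comp _ expR (fun y => - l * y^-1) x _ _
    (is_derive_expR (- l * x^-1)) dl.
  have dPe := is_deriveM dP de.
  rewrite (_ : flat_exp l _ x =
    P.[x^-1] *: (expR (- l * x^-1) * (- l *: (- x ^- 2 *: 1))) +
    expR (- l * x^-1) *: (P^`().[x^-1] * (- x ^- 2 *: 1))); last first.
    rewrite /flat_exp x0 /GRing.scale/= !hornerE /GRing.scale/= exprVn; ring.
  apply: near_eq_is_derive dPe; near=> y.
  by rewrite /flat_exp ifT//; near: y; exact: lt_nbhsr.
- rewrite {2}/flat_exp ltxx.
  (* At 0, boundedness for ['X^2 * P] instead of [P] gains a factor h^2, so the difference quotient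
     is O(h). *)
  have [C PC] := horner_expR_bounded ('X^2 * P) l0.
  have C0 : 0 <= C := le_trans (normr_ge0 _) (PC 1 ltr01).
  have bnd h : `|flat_exp l P h| <= C * h ^+ 2.
    rewrite /flat_exp; case: ifPn => [h0|_]; last first.
      by rewrite normr0 mulr_ge0// sqr_ge0.
    have := PC h^-1; rewrite invr_gt0 => /(_ h0).
    rewrite hornerM hornerXn -mulrA normrM ger0_norm ?sqr_ge0// exprVn.
    by rewrite ler_pdivrMl ?exprn_gt0// [_ * C]mulrC.
  have cv : h^-1 *: ((flat_exp l P \o shift 0) (h *: 1) - flat_exp l P 0)
      @[h --> (0 : R)^'] --> (0 : R).
    apply/cvgr0Pnorm_lt => e e0; near=> h.
    rewrite /= addr0 [h *: 1]mulr1 {2}/flat_exp ltxx subr0 normrZ normfV.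
    have h0 : h != 0 by near: h; exact: nbhs_dnbhs_neq.
    rewrite ltr_pdivrMl ?normr_gt0// (le_lt_trans (bnd _))//.
    rewrite -real_normK ?num_real// expr2 mulrA [ltLHS]mulrC ltr_pM2l ?normr_gt0//.
    (* [C] may vanish; [C + 1] can be divided by. *)
    rewrite (@le_lt_trans _ _ ((C + 1) * `|h|))// ?ler_wpM2r ?lerDl//.
    rewrite -ltr_pdivlMl ?ltr_wpDl//.
    near: h; apply: dnbhs0_lt; rewrite mulr_gt0 ?invr_gt0 ?ltr_wpDl//.
  by apply: DeriveDef; [exact: cvgP cv | exact: cvg_lim cv].
Unshelve. all: by end_near. Qed.

(* This class is stable under derivation, hence made of smooth functions. *)
Inductive flat_exp_products l c d : (R -> R) -> Prop :=
| flat_exp_prod P Q :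
    flat_exp_products l c d (fun x => flat_exp l P (x - c) * flat_exp l Q (d - x))
| flat_exp_add f g : flat_exp_products l c d f -> flat_exp_products l c d g ->
    flat_exp_products l c d (f + g).

Lemma flat_exp_products_derive l c d f : 0 < l -> flat_exp_products l c d f ->
  exists2 g, flat_exp_products l c d g & forall x, is_derive x 1 f (g x).
Proof.
move=> l0; elim=> [P Q|f1 f2 _ [g1 c1 d1] _ [g2 c2 d2]]; last first.
  by exists (g1 + g2); [exact: flat_exp_add | move=> x; exact: is_deriveD].
pose D P := 'X^2 * (l *: P - P^`()).
exists ((fun x => flat_exp l P (x - c) * flat_exp l (- D Q) (d - x)) +
        (fun x => flat_exp l (D P) (x - c) * flat_exp l Q (d - x))).
  by apply: flat_exp_add; exact: flat_exp_prod.
move=> x.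
have dc : is_derive x 1 (fun y => y - c) (1 - 0) by exact: is_deriveB.
have dd : is_derive x 1 (fun y => d - y) (0 - 1) by exact: is_deriveB.
have dP := @is_derive1_comp _ _ (fun y => y - c) x _ _
  (is_derive_flat_exp P (x - c) l0) dc.
have dQ := @is_derive1_comp _ _ (fun y => d - y) x _ _
  (is_derive_flat_exp Q (d - x) l0) dd.
apply: (is_derive_eq (is_deriveM dP dQ)) => /=.
rewrite -/(D Q) -/(D P) /GRing.scale/= subr0 mulr1 [X in _ + X]mulrC; congr (_ + _).
congr (_ * _); rewrite /flat_exp; case: ifP; rewrite ?mul0r// => _.
by rewrite hornerN sub0r mulrN1 [RHS]mulNr.
Qed.

Lemma flat_exp_products_smooth l c d f k : 0 < l -> flat_exp_products l c d f ->
  flat_exp_products l c d (f^`(k))%classic /\ forall x, derivable (f^`(k))%classic x 1.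
Proof.
move=> l0 cf; suff cfk : flat_exp_products l c d (f^`(k))%classic.
  by split=> // x; have [g _ /(_ x)[]] := flat_exp_products_derive l0 cfk.
elim: k => [//|k /(flat_exp_products_derive l0)[g cg fg]].
rewrite derive1nS (_ : derive1 _ = g)//; apply/funext => x.
by rewrite derive1E; case: (fg x).
Qed.

(** As [l] tends to 0 these bumps converge to the indicator of []c, d[] while their supports stay in
    [[c, d]], so indicators are approximated without convolution. *)
Definition smooth_bump l c d x := flat_exp l 1 (x - c) * flat_exp l 1 (d - x).

Lemma smooth_bumpE l c d x : smooth_bump l c d x =
  if (x \in `]c, d[) then expR (- l * ((x - c)^-1 + (d - x)^-1)) else 0.
Proof.
rewrite /smooth_bump /flat_exp in_itv/= !subr_gt0 !hornerC !mul1r.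
by case: ltP => _; case: ltP => _; rewrite ?mul0r ?mulr0// -expRD mulrDr.
Qed.

Lemma smooth_bump_ge0_le1 l c d x : 0 < l -> 0 <= smooth_bump l c d x <= 1.
Proof.
move=> l0; rewrite smooth_bumpE; case: ifP; rewrite ?lexx ?ler01// in_itv/= => /andP[cx xd].
rewrite expR_ge0/= -expR0 ler_expR mulNr oppr_le0 mulr_ge0 ?ltW//.
by rewrite addr_gt0// invr_gt0 subr_gt0.
Qed.

Lemma cvg_smooth_bump c d x :
  smooth_bump n.+1%:R^-1 c d x @[n --> \oo] --> (\1_`]c, d[ x : R).
Proof.
under eq_fun do rewrite smooth_bumpE; rewrite indicE mem_setE.
have [_|_] := boolP (x \in `]c, d[); last exact: cvg_cst.
have h0 : - (n.+1%:R^-1 : R) * ((x - c)^-1 + (d - x)^-1) @[n --> \oo] -->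
    - (0 : R) * ((x - c)^-1 + (d - x)^-1).
  by apply: cvgM; [apply: cvgN; exact: cvg_harmonic | exact: cvg_cst].
rewrite oppr0 mul0r in h0.
have := continuous_cvg _ (@continuous_expR R 0) h0; rewrite expR0; exact.
Qed.

Lemma smooth_bump_test_function l a b c d : 0 < l -> a < c -> d < b ->
  test_function a b (smooth_bump l c d).
Proof.
move=> l0 ac db.
have supp : closure [set x | smooth_bump l c d x != 0] `<=` `[c, d].
  rewrite (closure_id `[c, d]).1; last exact: interval_closed.
  apply: closure_subset => x /=; rewrite smooth_bumpE; case: ifPn; rewrite ?eqxx// => + _.
  exact: subset_itv_oo_cc.
split.
- have bump_prod : flat_exp_products l c d (smooth_bump l c d).
    exact: flat_exp_prod.
  by move=> k; have [] := flat_exp_products_smooth k l0 bump_prod.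
- apply: (subclosed_compact _ (@segment_compact _ c d)) => //.
  exact: closed_closure.
- apply: subset_trans supp _ => x /=; rewrite !in_itv/= => /andP[cx xd].
  by rewrite (lt_le_trans ac)//= (le_lt_trans xd).
Qed.

End smooth_bump.

(** * The fundamental lemma of the calculus of variations *)

Section du_bois_reymond.
Context {R : realType}.
Local Notation mu := (@lebesgue_measure R).
Implicit Types (a b c d : R) (f : R -> R).

Lemma integrable_segment a b c d f : locally_integrable `]a, b[ f ->
  a < c -> d < b -> mu.-integrable `[c, d] (EFin \o f).
Proof.
move=> [mf _ lf] ac db.
have sub : `[c, d] `<=` `]a, b[.
  move=> x /=; rewrite !in_itv/= => /andP[cx xd].
  by rewrite (lt_le_trans ac)//= (le_lt_trans xd).
apply/integrableP; split; last exact: lf (@segment_compact _ c d).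
by apply/measurable_EFinP; exact: measurable_funS mf.
Qed.

(** Dominated convergence along the bumps with rates 1/(n+1): they lie between 0 and 1, so |f|
    dominates, and it is integrable on the compact [[c, d]]. *)
Lemma Rintegral_eq0_of_test_functions a b c d f :
  locally_integrable `]a, b[ f ->
  (forall phi, test_function a b phi ->
     \int[mu]_(x in `]a, b[) (f x * phi x) = 0) ->
  a < c -> d < b -> \int[mu]_(x in `[c, d]) f x = 0.
Proof.
move=> lf f0 ac db.
have int_cd := integrable_segment lf ac db.
pose g n x := (f x * smooth_bump n.+1%:R^-1 c d x)%:E.
have l0 n : 0 < n.+1%:R^-1 :> R by rewrite invr_gt0.
have int_oo : mu.-integrable `]c, d[ (EFin \o f).
  by apply: integrableS int_cd => //; exact: subset_itv_oo_cc.
have mf : measurable_fun `]c, d[ (EFin \o f) by case/integrableP : int_oo.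
have mbump n : measurable_fun `]c, d[ (smooth_bump n.+1%:R^-1 c d).
  apply: measurable_funS (measurableT) _ _ => //.
  apply: continuous_measurable_fun => x.
  have [/(_ 0%N x) + _ _] := smooth_bump_test_function (l0 n) ac db.
  by move=> /derivable1_diffP/differentiable_continuous.
have mg n : measurable_fun `]c, d[ (g n).
  apply/measurable_EFinP; apply: measurable_funM (mbump n).
  exact/measurable_EFinP.
have gf : {ae mu, forall x, [set` `]c, d[] x -> g ^~ x @ \oo --> (EFin \o f) x}.
  apply: aeW => x xcd; apply/fine_cvgP; split; first by near=> n.
  rewrite /= -[X in _ --> X]mulr1.
  apply: cvgM; first exact: cvg_cst.
  have := @cvg_smooth_bump R c d x; rewrite indicE mem_setE.
  by rewrite [x \in _]xcd.
have gle : {ae mu, forall x n, [set` `]c, d[] x ->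
    (`|g n x| <= (abse \o (EFin \o f)) x)%E}.
  apply: aeW => x n _; rewrite /g /= lee_fin normrM ler_piMr//.
  by have /andP[h0 h1] := smooth_bump_ge0_le1 c d x (l0 n); rewrite ger0_norm.
have [_ _] := @dominated_convergence _ (measurableTypeR R) R mu `]c, d[
  (measurable_itv _) g (EFin \o f) _ mg mf gf (integrable_abse int_oo) gle.
have g0 n : (\int[mu]_(x in `]c, d[) (g n x) = 0)%E.
  have int_g : mu.-integrable `]c, d[ (g n).
    apply: (le_integrable _ _ _ int_oo) => //; first exact: mg.
    move=> x _.
    rewrite /g /= lee_fin normrM ler_piMr//.
    by have /andP[h0 h1] := smooth_bump_ge0_le1 c d x (l0 n); rewrite ger0_norm.
  rewrite -[LHS]fineK ?integrable_fin_num//; congr EFin.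
  rewrite -[RHS](f0 _ (smooth_bump_test_function (l0 n) ac db)).
  rewrite Rintegral_mkcond [LHS]Rintegral_mkcond; congr (Rintegral _ _ _).
  apply/funext => x; rewrite !patchE !mem_setE.
  case: ifPn => [xcd|xcd]; last first.
    by case: ifPn => // _; rewrite smooth_bumpE (negbTE xcd) mulr0.
  rewrite ifT//; move: xcd; rewrite !in_itv/= => /andP[cx xd].
  by rewrite (lt_trans ac)//= (lt_trans xd).
rewrite (_ : [sequence _]_n = cst 0%E); last by apply/funext => n; exact: g0.
move=> /(cvg_unique _ (cvg_cst 0%E)) -/(_ (@ereal_hausdorff R)) intf0.
by rewrite /Rintegral integral_itv_bndoo// -intf0.
Unshelve. all: by end_near. Qed.

(** Since f is integrable only on compact subsets, the interval is exhausted by the []c k, d k[]. On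
    each of them the primitive of f from [c k] is identically zero, and Lebesgue differentiation
    recovers f from it almost everywhere. *)
Lemma du_bois_reymond a b f :
  locally_integrable `]a, b[ f ->
  (forall phi, test_function a b phi ->
     \int[mu]_(x in `]a, b[) (f x * phi x) = 0) ->
  {ae mu, forall x, x \in `]a, b[ -> f x = 0}.
Proof.
move=> lf f0.
pose c k : R := a + k.+1%:R^-1; pose d k := b - k.+1%:R^-1.
have ac k : a < c k by rewrite ltrDl invr_gt0.
have db k : d k < b by rewrite gtrDl oppr_lt0 invr_gt0.
have key k : {ae mu, forall x, x \in `]c k, d k[ -> f x = 0}.
  have int_cd := integrable_segment lf (ac k) (db k).
  have mcd : measurable (`[c k, d k] : set (measurableTypeR R)).
    exact: measurable_itv.
  have := @FTC1 R (f \_ `[c k, d k]) (BLeft (c k)) _ (integrable_locally mcd int_cd).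
  have h y : mu.-integrable [set` Interval (BLeft (c k)) (BRight y)]
     (EFin \o (f \_ `[c k, d k])).
    apply: (@integrableS _ _ _ _ setT) => //.
    by have := int_cd; rewrite [X in X -> _]integrable_mkcond//= (restrict_EFin f).
  move=> /(_ h) {h}; apply: (@filterS _ _ (ae_filter_ringOfSetsType mu)) => x H.
  rewrite in_itv/= => /andP[cx xd].
  have /H[_] : (BLeft (c k) < BRight x)%E by rewrite /= lte_fin.
  rewrite patchE mem_set/=; last by rewrite in_itv/= !ltW.
  move=> <-; rewrite derive1E.
  rewrite (near_eq_derive _ (g := cst 0)) ?derive_cst//.
  near=> y.
  have cy : c k < y by near: y; exact: lt_nbhsr.
  have yd : y < d k by near: y; exact: lt_nbhsl.
  rewrite -(Rintegral_eq0_of_test_functions lf f0 (ac k) (lt_trans yd (db k))).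
  apply: eq_Rintegral => z; rewrite inE/= in_itv/= => /andP[cz zy].
  by rewrite patchE mem_set//= in_itv/= cz (le_trans zy)// ltW.
move/ae_foralln : key; apply: (@filterS _ _ (ae_filter_ringOfSetsType mu)) => x H.
rewrite in_itv/= => /andP[ax xb].
have m0 : 0 < Num.min (x - a) (b - x) by rewrite lt_min !subr_gt0 ax.
have [k kx] : exists k : nat, k.+1%:R^-1 < Num.min (x - a) (b - x).
  have [k _ kx] := near_infty_natSinv_lt (PosNum m0).
  by exists k; exact: kx k (leqnn k).
apply: (H k); move: kx; rewrite lt_min in_itv/= /c /d => /andP[h1 h2].
by rewrite -ltrBrDl h1 ltrBrDr -ltrBrDl.
Unshelve. all: by end_near. Qed.
End du_bois_reymond.

(** * Piecewise continuous functions and test functions *)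

Section piecewise.
Context {R : realType}.
Local Notation mu := (@lebesgue_measure R).
Implicit Types (a b h s t : R) (f g G : R -> R) (n j : nat).

(** Each piece is required to extend continuously to the whole line: this gives integrability up to
    the open left end of the cell, and the half-open cells are those of [spline]. *)
Definition pw_continuous a h n f := forall j, (j < n)%N ->
  exists2 g, continuous g & {in `]a + h * j%:R, a + h * j.+1%:R], f =1 g}.

Lemma pw_continuousM a h n f g :
  pw_continuous a h n f -> pw_continuous a h n g ->
  pw_continuous a h n (fun x => f x * g x).
Proof.
move=> pf pg j jn; have [F cF fF] := pf j jn; have [G cG gG] := pg j jn.
exists (F \* G) => [x|x xj]; first by apply: continuousM; [exact: cF|exact: cG].
by rewrite fF// gG.
Qed.

Lemma pw_continuousD a h n f g :
  pw_continuous a h n f -> pw_continuous a h n g ->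
  pw_continuous a h n (fun x => f x + g x).
Proof.
move=> pf pg j jn; have [F cF fF] := pf j jn; have [G cG gG] := pg j jn.
exists (F \+ G) => [x|x xj]; first by apply: continuousD; [exact: cF|exact: cG].
by rewrite fF// gG.
Qed.

Lemma continuous_pw a h n f : continuous f -> pw_continuous a h n f.
Proof. by move=> cf j _; exists f. Qed.

Lemma pw_continuousN a h n f :
  pw_continuous a h n f -> pw_continuous a h n (fun x => - f x).
Proof.
move=> pf j jn; have [F cF fF] := pf j jn.
exists (\- F) => [x|x xj]; first by apply: continuousN; exact: cF.
by rewrite fF.
Qed.

Lemma continuous_integrable_oc s t g : continuous g ->
  mu.-integrable `]s, t] (EFin \o g).
Proof.
move=> cg; apply: (@integrableS _ _ _ mu `[s, t]) => //.
- exact: subset_itv_oc_cc.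
- apply: continuous_compact_integrable; first exact: segment_compact.
  exact: continuous_subspaceT.
Qed.

Lemma cell_integrable s t f g : continuous g -> {in `]s, t], f =1 g} ->
  mu.-integrable `]s, t] (EFin \o f).
Proof.
move=> cg fg; have := continuous_integrable_oc s t cg.
apply: eq_integrable => // x; rewrite inE/= => xst.
by rewrite /= fg.
Qed.

Lemma integrable_setU (A B : set R) f : measurable A -> measurable B ->
  [disjoint A & B] ->
  mu.-integrable A (EFin \o f) -> mu.-integrable B (EFin \o f) ->
  mu.-integrable (A `|` B) (EFin \o f).
Proof.
move=> mA mB AB /integrableP[mfA ifA] /integrableP[mfB ifB].
have mf : measurable_fun (A `|` B) (EFin \o f) by apply/measurable_funU.
apply/integrableP; split=> //.
rewrite ge0_integral_setU//; first exact: lte_add_pinfty.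
by apply: measurableT_comp mf.
Qed.

Lemma disjoint_itv_oc (a b c : R) : [disjoint `]a, b]%classic & `]b, c]%classic].
Proof.
apply/disj_setPS => y [/=]; rewrite 2!in_itv/= => /andP[_ yx] /andP[].
by rewrite ltNge yx.
Qed.

Lemma pw_itv_setU a h n : 0 < h ->
  `]a, a + h * n.+1%:R]%classic =
  `]a, a + h * n%:R]%classic `|` `]a + h * n%:R, a + h * n.+1%:R]%classic.
Proof.
move=> h0; apply: itv_bndbnd_setU; rewrite bnd_simp.
  by rewrite lerDl mulr_ge0// ltW.
by rewrite lerD2l ler_pM2l// ler_nat.
Qed.

Lemma pw_integrable a h n f : 0 < h -> pw_continuous a h n f ->
  mu.-integrable `]a, a + h * n%:R] (EFin \o f).
Proof.
move=> h0; elim: n => [_|n IH pf].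
  by rewrite mulr0 addr0 set_itvoc0; exact: integrable_set0.
rewrite pw_itv_setU//; apply: integrable_setU => //; first exact: disjoint_itv_oc.
  by apply: IH => j jn; apply: pf; exact: ltnW.
by have [g cg fg] := pf n (ltnSn n); exact: cell_integrable fg.
Qed.

Lemma pw_Rintegral a h n f : 0 < h -> pw_continuous a h n f ->
  \int[mu]_(x in `]a, a + h * n%:R]) f x =
  \sum_(j < n) \int[mu]_(x in `]a + h * j%:R, a + h * j.+1%:R]) f x.
Proof.
move=> h0; elim: n => [_|n IH pf].
  by rewrite mulr0 addr0 set_itvoc0 Rintegral_set0 big_ord0.
have := pw_integrable h0 pf; rewrite pw_itv_setU// => int_f.
rewrite Rintegral_setU//; last exact: disjoint_itv_oc.
by rewrite big_ord_recr/= IH// => j jn; apply: pf; exact: ltnW.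
Qed.

Lemma cell_FTC s t f g G : s < t -> continuous g ->
  (forall x : R, is_derive x 1 G (g x)) -> {in `]s, t], f =1 g} ->
  \int[mu]_(x in `]s, t]) f x = G t - G s.
Proof.
move=> st cg dG fg; rewrite (@eq_Rintegral _ _ _ mu _ g); last by move=> x; rewrite inE/= => /fg.
rewrite Rintegral_itv_obnd_cbnd; last exact: continuous_integrable_oc.
have cG : continuous G.
  move=> x; have [dx _] := dG x.
  by apply: differentiable_continuous; exact/derivable1_diffP.
rewrite /Rintegral (@continuous_FTC2 _ g G)//.
- exact: continuous_subspaceT.
- split => [x _||]; first by have [] := dG x.
    by apply: cvg_at_right_filter; exact: cG.
  by apply: cvg_at_left_filter; exact: cG.
- by move=> x _; rewrite derive1E; have [_ ->] := dG x.
Qed.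

Lemma pw_integrable_oo a h n f : 0 < h -> pw_continuous a h n f ->
  mu.-integrable `]a, a + h * n%:R[ (EFin \o f).
Proof.
move=> h0 pf; apply: integrableS (pw_integrable h0 pf) => //.
exact: subset_itv_oo_oc.
Qed.

Lemma pw_Rintegral_oo a h n f : 0 < h -> pw_continuous a h n f ->
  \int[mu]_(x in `]a, a + h * n%:R[) f x =
  \sum_(j < n) \int[mu]_(x in `]a + h * j%:R, a + h * j.+1%:R]) f x.
Proof.
move=> h0 pf; rewrite Rintegral_itv_bndo_bndc ?pw_Rintegral//.
exact: pw_integrable_oo.
Qed.

Lemma L2_normE a b f : mu.-integrable `]a, b[ (EFin \o (fun x => f x ^+ 2)) ->
  L2_norm a b f = (Num.sqrt (\int[mu]_(x in `]a, b[) (f x ^+ 2)))%:E.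
Proof.
move=> int_f; rewrite /L2_norm unlock -powR12_sqrt; last first.
  by apply: Rintegral_ge0 => x _; exact: sqr_ge0.
rewrite -poweR_EFin fineK ?integrable_fin_num//; congr (_ `^ _)%E.
rewrite [RHS]integral_mkcond; apply: eq_integral => x _.
rewrite /= !patchE; case: ifPn => _ /=.
  by rewrite powR_mulrn// real_normK// num_real.
by rewrite normr0 powR0// pnatr_eq0.
Qed.

Lemma pw_in_L2 a h n f : 0 < h -> pw_continuous a h n f ->
  in_L2 a (a + h * n%:R) f.
Proof.
move=> h0 pf; rewrite /in_L2 inE; apply/andP; split; rewrite inE/=.
  have /integrableP[mf _] := pw_integrable_oo h0 pf.
  by apply/(measurable_restrictT _ _).1 => //; exact/measurable_EFinP.
have pf2 : pw_continuous a h n (fun x => f x ^+ 2) by exact: pw_continuousM.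
rewrite /finite_norm -/(L2_norm a (a + h * n%:R) f) L2_normE ?ltry//.
exact: pw_integrable_oo.
Qed.

Lemma pw_locally_integrable a h n f : 0 < h -> pw_continuous a h n f ->
  locally_integrable `]a, a + h * n%:R[ f.
Proof.
move=> h0 pf; apply: open_integrable_locally; first exact: interval_open.
exact: pw_integrable_oo.
Qed.

End piecewise.

Section test_function.
Context {R : realType}.
Implicit Types (a b s t x : R) (phi : R -> R) (k : nat).

Lemma test_function_is_derive a b phi k x : test_function a b phi ->
  is_derive x 1 (phi^`(k))%classic ((phi^`(k.+1))%classic x).
Proof.
by move=> [dphi _ _]; split; rewrite ?derive1nS ?derive1E//; exact: dphi.
Qed.

Lemma test_function_continuous a b phi k : test_function a b phi ->
  continuous (phi^`(k))%classic.
Proof.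
move=> [dphi _ _] x; apply: differentiable_continuous.
by apply/derivable1_diffP; exact: dphi.
Qed.

Lemma test_function_sub a b s t phi : a <= s -> t <= b ->
  test_function s t phi -> test_function a b phi.
Proof.
move=> as_ tb [dphi cphi sphi]; split=> //; apply: subset_trans sphi _ => x /=.
by rewrite !in_itv/= => /andP[sx xt]; rewrite (le_lt_trans as_)//= (lt_le_trans xt).
Qed.

Lemma test_function_eq0 a b phi x : test_function a b phi ->
  x \notin `]a, b[ -> phi x = 0.
Proof.
move=> [_ _ sphi] xab; apply/eqP/negPn/negP => phix; move/negP : xab; apply.
by apply: sphi; exact: subset_closure.
Qed.

Lemma test_function_derive a b phi : test_function a b phi ->
  test_function a b (phi^`())%classic.
Proof.
move=> [dphi cphi sphi].
have supp : closure [set x | (phi^`())%classic x != 0] `<=` closure [set x | phi x != 0].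
  rewrite [X in _ `<=` X](closure_id _).1; last exact: closed_closure.
  apply: closure_subset => x /=; apply: contraPP => xphi; apply/negP.
  rewrite negbK derive1E (near_eq_derive _ (g := cst 0)) ?derive_cst//.
  have : open (~` closure [set x | phi x != 0]).
    by rewrite openC; exact: closed_closure.
  rewrite openE => /(_ x xphi); rewrite /interior; apply: filterS => y /= yphi.
  by apply/eqP/negPn/negP => phiy; apply: yphi; exact: subset_closure.
split.
- by move=> k x; have := dphi k.+1 x; rewrite /derive1n iterSr.
- exact: subclosed_compact (@closed_closure _ _) cphi supp.
- exact: subset_trans supp sphi.
Qed.

Lemma test_function_derive1n a b phi k : test_function a b phi ->
  test_function a b (phi^`(k))%classic.
Proof.
by move=> tphi; elim: k => [//|k IH]; rewrite derive1nS; exact: test_function_derive.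
Qed.

End test_function.

(** * Matching of the pieces of an H^p spline *)

Section weak_derivatives.
Context {R : realType}.
Local Notation mu := (@lebesgue_measure R).
Implicit Types (a b s t h x : R) (f v w phi : R -> R) (k : nat) (q : {poly R}).

Lemma Rintegral_support (A B : set R) f : A `<=` B ->
  (forall x, B x -> ~ A x -> f x = 0) ->
  \int[mu]_(x in B) f x = \int[mu]_(x in A) f x.
Proof.
move=> AB f0; rewrite Rintegral_mkcond [RHS]Rintegral_mkcond.
congr (Rintegral _ _ _); apply/funext => x; rewrite !patchE.
case: ifPn => [|/negP]; rewrite inE => xB.
  by case: ifPn => // /negP; rewrite inE => xA; rewrite f0.
by rewrite ifF//; apply/negbTE/negP; rewrite inE => /AB.
Qed.

Lemma integrableM_test_function a b f phi : locally_integrable `]a, b[ f ->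
  test_function a b phi ->
  mu.-integrable `]a, b[ (EFin \o (fun x => f x * phi x)).
Proof.
move=> [mf _ lf] tphi; have [_ cK Kab] := tphi.
set K := closure _ in cK Kab.
have mK : measurable K by exact: compact_measurable.
have cphi : continuous phi := @test_function_continuous _ _ _ _ 0 tphi.
have int_K : mu.-integrable K (EFin \o f).
  apply/integrableP; split; last exact: lf.
  by apply/measurable_EFinP; exact: measurable_funS mf.
have bK : [bounded phi x | x in K].
  have := continuous_compact (continuous_subspaceT (A := K) cphi) cK.
  move=> /compact_bounded[M [rM MK]]; exists M; split=> // x Mx y Ky.
  by apply: (MK x Mx); exists y.
have int_fphi : mu.-integrable K (EFin \o (fun x => f x * phi x)).
  have mphi : measurable_fun K phi by apply: measurable_funTS; exact: continuous_measurable_fun.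
  have := @integrableMl _ _ _ mu K mK _ _ int_K mphi bK.
  by apply: eq_integrable => // x _.
move: int_fphi; rewrite integrable_mkcond// [X in _ -> X]integrable_mkcond//.
apply: eq_integrable => // x _; rewrite !patchE.
case: ifPn => [|/negP]; rewrite inE => xK; first by rewrite mem_set//; exact: Kab.
case: ifPn => // _ /=; suff -> : phi x = 0 by rewrite mulr0.
by apply/eqP/negPn/negP => phix; apply: xK; exact: subset_closure.
Qed.

(** At [t] the left piece is taken, in keeping with the half-open cells of a spline. *)
Definition glue_poly t q1 q2 x := if x <= t then q1.[x] else q2.[x].

Lemma glue_poly_pw_continuous s h q1 q2 :
  pw_continuous s h 2 (glue_poly (s + h) q1 q2).
Proof.
move=> [|[|//]] _.
- exists (horner q1) => x; first exact: continuous_horner.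
  by rewrite in_itv/= mulr1 /glue_poly => /andP[_ ->].
- exists (horner q2) => x; first exact: continuous_horner.
  by rewrite in_itv/= mulr1 /glue_poly => /andP[sx _]; rewrite leNgt sx.
Qed.

(** Integration by parts on both cells: phi vanishes at the outer ends, and the two boundary terms
    at the node leave the jump. *)
Lemma Rintegral_glue s h q1 q2 phi : 0 < h ->
  test_function s (s + h * 2) phi ->
  \int[mu]_(x in `]s, s + h * 2[)
     (glue_poly (s + h) q1 q2 x * (phi^`())%classic x
      + glue_poly (s + h) q1^`() q2^`() x * phi x) =
  (q1.[s + h] - q2.[s + h]) * phi (s + h).
Proof.
move=> h0 tphi.
have c0 : continuous phi := @test_function_continuous _ _ _ _ 0 tphi.
have c1 : continuous (phi^`())%classic := @test_function_continuous _ _ _ _ 1 tphi.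
have cG q : continuous (fun x => q.[x] * (phi^`())%classic x + q^`().[x] * phi x).
  by move=> x; apply: cvgD; apply: cvgM;
    [exact: continuous_horner|exact: c1|exact: continuous_horner|exact: c0].
have dG q (x : R) : is_derive x 1 (fun y => q.[y] * phi y)
    (q.[x] * (phi^`())%classic x + q^`().[x] * phi x).
  have dM := is_deriveM (is_derive_poly q x) (test_function_is_derive 0 x tphi).
  by apply: (is_derive_eq dM); rewrite /GRing.scale/= [X in _ + X]mulrC.
rewrite pw_Rintegral_oo//; last first.
  apply: pw_continuousD; apply: pw_continuousM; try exact: glue_poly_pw_continuous;
  by apply: continuous_pw; [exact: c1 || exact: c0].
rewrite big_ord_recr big_ord1/= mulr0 addr0 mulr1.
rewrite (cell_FTC _ (cG q1) (dG q1)) ?ltrDl//; last first.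
  by move=> x; rewrite in_itv/= /glue_poly => /andP[_ ->].
rewrite (cell_FTC _ (cG q2) (dG q2)); last first.
- by move=> x; rewrite in_itv/= /glue_poly => /andP[sx _]; rewrite leNgt sx.
- by rewrite ltrD2l ltr_pMr// ltr1n.
rewrite (test_function_eq0 tphi (x := s)) ?in_itv/= ?ltxx//.
rewrite (test_function_eq0 tphi (x := s + h * 2)) ?in_itv/= ?ltxx ?andbF//.
by rewrite !mulr0 subr0 sub0r mulrBl.
Qed.

(** Each of the k integrations by parts leaves a jump of some order i < k, which is zero by
    assumption. *)
Lemma Rintegral_derive1n_glue s h q1 q2 k phi : 0 < h ->
  test_function s (s + h * 2) phi ->
  (forall i, (i < k)%N -> q1^`(i).[s + h] = q2^`(i).[s + h]) ->
  \int[mu]_(x in `]s, s + h * 2[) (glue_poly (s + h) q1 q2 x * (phi^`(k))%classic x) =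
  (-1) ^+ k * \int[mu]_(x in `]s, s + h * 2[)
                 (glue_poly (s + h) q1^`(k) q2^`(k) x * phi x).
Proof.
move=> h0; elim: k phi => [|k IH] phi tphi qk; first by rewrite mul1r.
have /= := IH _ (test_function_derive tphi) (fun i ik => qk i (ltnW ik)).
rewrite /derive1n -iterSr => ->; rewrite exprS mulN1r mulNr -mulrN; congr (_ * _).
have c0 : continuous phi := @test_function_continuous _ _ _ _ 0 tphi.
have c1 : continuous (phi^`())%classic := @test_function_continuous _ _ _ _ 1 tphi.
apply/eqP; rewrite -addr_eq0; apply/eqP.
rewrite -RintegralD//; last 2 first.
- by apply: pw_integrable_oo => //; apply: pw_continuousM;
    [exact: glue_poly_pw_continuous | exact: continuous_pw].
- by apply: pw_integrable_oo => //; apply: pw_continuousM;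
    [exact: glue_poly_pw_continuous | exact: continuous_pw].
by rewrite Rintegral_glue// qk// subrr mul0r.
Qed.

Lemma Rintegral_ae_eq0 s t f : measurable_fun `]s, t[ f ->
  {ae mu, forall x, x \in `]s, t[ -> f x = 0} ->
  \int[mu]_(x in `]s, t[) f x = 0.
Proof.
move=> mf f0; rewrite /Rintegral (@ae_eq_integral _ _ _ mu `]s, t[ (cst 0%E)) ?integral0//.
  exact/measurable_EFinP.
by apply: (@filterS _ _ (ae_filter_ringOfSetsType mu)) f0 => x f0 xst; rewrite f0.
Qed.

(** A test function supported on one side of [t] vanishes at [t], so du Bois-Reymond makes f zero
    almost everywhere on both sides. Testing with a bump that is positive at [t] then leaves D =
    0. *)
Lemma ae_eq0_of_delta s r t D f : s < t -> t < r ->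
  locally_integrable `]s, r[ f ->
  (forall phi, test_function s r phi ->
     \int[mu]_(x in `]s, r[) (f x * phi x) = D * phi t) ->
  D = 0.
Proof.
move=> st tr lf fD.
have sub (c d : R) : s <= c -> d <= r -> (t <= c) || (d <= t) ->
    {ae mu, forall x, x \in `]c, d[ -> f x = 0}.
  move=> sc dr tcd.
  have cdsr : `]c, d[ `<=` `]s, r[.
    by move=> x /=; rewrite !in_itv/= => /andP[cx xd];
      rewrite (le_lt_trans sc)//= (lt_le_trans xd).
  apply: du_bois_reymond => [|phi tphi].
    have [mf _ lf'] := lf; split; first exact: measurable_funS mf.
      exact: interval_open.
    by move=> K Kcd; apply: lf'; exact: subset_trans cdsr.
  rewrite -(Rintegral_support cdsr); last first.
    move=> x _ xcd; rewrite (test_function_eq0 tphi) ?mulr0//.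
    by apply/negP.
  rewrite fD; last exact: test_function_sub tphi.
  rewrite (test_function_eq0 tphi) ?mulr0// in_itv/= negb_and -!leNgt.
  by [].
have ae_t : {ae mu, forall x, x != t}.
  exists [set t]; split => //; first exact: lebesgue_measure_set1.
  by move=> x /= /negP; rewrite negbK => /eqP.
have f0 : {ae mu, forall x, x \in `]s, r[ -> f x = 0}.
  have F := ae_filter_ringOfSetsType mu.
  have f1 := sub s t (lexx s) (ltW tr); rewrite lexx orbT in f1.
  have f2 := sub t r (ltW st) (lexx r); rewrite lexx in f2.
  have := @filterI _ _ F _ _ (@filterI _ _ F _ _ (f1 isT) (f2 isT)) ae_t.
  apply: (@filterS _ _ F) => x [[{}f1 {}f2] xt].
  rewrite in_itv/= => /andP[sx xr]; move: xt; rewrite neq_lt => /orP[xt|tx].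
    by apply: f1; rewrite in_itv/= sx.
  by apply: f2; rewrite in_itv/= tx.
pose c := (s + t) / 2; pose d := (t + r) / 2.
have [sc ct] : s < c /\ c < t by rewrite /c; split; lra.
have [td dr] : t < d /\ d < r by rewrite /d; split; lra.
have tphi := smooth_bump_test_function (@ltr01 R) sc dr.
have := fD _ tphi; rewrite Rintegral_ae_eq0.
- move=> /esym/eqP; rewrite mulf_eq0 smooth_bumpE in_itv/= ct td/=.
  by rewrite expR_eq0 orbF => /eqP.
- apply: measurable_funM; first by have [] := lf.
  apply: measurable_funTS; apply: continuous_measurable_fun.
  exact: (@test_function_continuous _ _ _ _ 0 tphi).
- by apply: (@filterS _ _ (ae_filter_ringOfSetsType mu)) f0 => x H xsr; rewrite H// mul0r.
Qed.

(** Strong induction on k: matching at lower orders removes all boundary terms but the jump of order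
    k. Since k < p, the space H^p provides a weak derivative w of order k+1; it differs from the
    glued classical derivative by that jump times a Dirac mass. *)
Lemma H_pieces_derivn a b s h p v q1 q2 : 0 < h -> a <= s -> s + h * 2 <= b ->
  in_H a b p v -> {in `]s, s + h * 2[, v =1 glue_poly (s + h) q1 q2} ->
  forall k, (k < p)%N -> q1^`(k).[s + h] = q2^`(k).[s + h].
Proof.
move=> h0 as_ rb [_ vH] vq; elim/ltn_ind => k IH kp.
have [w [_ lw vw] _] := vH k.+1 kp.
have sub : `]s, s + h * 2[ `<=` `]a, b[.
  by move=> x /=; rewrite !in_itv/= => /andP[sx xr];
    rewrite (le_lt_trans as_)//= (lt_le_trans xr).
have qk i : (i < k)%N -> q1^`(i).[s + h] = q2^`(i).[s + h].
  by move=> ik; apply: IH => //; exact: ltn_trans kp.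
have lw' : locally_integrable `]s, s + h * 2[ w.
  have [mw _ lw'] := lw; split; first exact: measurable_funS mw.
    exact: interval_open.
  by move=> K Ks; apply: lw'; exact: subset_trans sub.
have lg : locally_integrable `]s, s + h * 2[ (glue_poly (s + h) q1^`(k.+1) q2^`(k.+1)).
  by apply: pw_locally_integrable => //; exact: glue_poly_pw_continuous.
apply/eqP; rewrite -subr_eq0; apply/eqP.
apply: (@ae_eq0_of_delta s (s + h * 2) (s + h) _
  (glue_poly (s + h) q1^`(k.+1) q2^`(k.+1) \- w)).
- by rewrite ltrDl.
- by rewrite ltrD2l ltr_pMr// ltr1n.
- exact: locally_integrableB.
move=> phi tphi.
have tphi_ab : test_function a b phi by exact: test_function_sub tphi.
have := vw _ tphi_ab.
rewrite !(Rintegral_support sub); last 2 first.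
- by move=> x _ /negP xs; rewrite (test_function_eq0 tphi) ?mulr0.
- move=> x _ /negP xs.
  by rewrite (test_function_eq0 (test_function_derive1n _ tphi)) ?mulr0.
rewrite (@eq_Rintegral _ _ _ mu _
  (fun x => glue_poly (s + h) q1 q2 x * (phi^`(k.+1))%classic x)); last first.
  by move=> x; rewrite inE/= => xs; rewrite vq.
(* Only k integrations by parts are made here, with the derivative of phi as test function; the last
   one, which produces the jump, is left to [Rintegral_glue]. *)
have /= := Rintegral_derive1n_glue h0 (test_function_derive tphi) qk.
rewrite /derive1n -iterSr => ->; rewrite exprS mulN1r mulNr -mulrN.
move=> /(mulfI _) -/(_ _)/wrap[|H]; first by rewrite expf_neq0// oppr_eq0 oner_eq0.
under eq_Rintegral do rewrite /= mulrBl.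
rewrite RintegralB//; [|exact: integrableM_test_function..].
rewrite -[X in _ - X]opprK -H opprK addrC.
rewrite -Rintegral_glue//= RintegralD//.
- by apply: pw_integrable_oo => //; apply: pw_continuousM;
    [exact: glue_poly_pw_continuous | apply: continuous_pw;
     exact: (@test_function_continuous _ _ _ _ 1 tphi)].
- by apply: pw_integrable_oo => //; apply: pw_continuousM;
    [exact: glue_poly_pw_continuous | apply: continuous_pw;
     exact: (@test_function_continuous _ _ _ _ 0 tphi)].
Qed.

End weak_derivatives.

(** * Polynomial pieces of reduced splines *)

Section spline_pieces.
Context {R : realType}.
Implicit Types (a b s t h x : R) (v : R -> R) (k p N : nat) (q : {poly R}).

(** A linear model of the reduced splines: regularity becomes equations at the N interior nodes, and
    there are N+1 cells because n is positive. *)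
Definition spline_pieces a h p N (w : {ffun 'I_N.+1 -> {poly R}}) : Prop :=
  [/\ forall j, (size (w j) <= p.+1)%N,
      forall j k, (j < N)%N -> (k < p)%N ->
        (w (inord j))^`(k).[a + h * j.+1%:R] =
        (w (inord j.+1))^`(k).[a + h * j.+1%:R] &
      forall l, (l.*2.+1 < p)%N ->
        (w ord0)^`(l.*2.+1).[a] = 0 /\
        (w ord_max)^`(l.*2.+1).[a + h * N.+1%:R] = 0].

Lemma spline_pieces_linear a h p N (c : R) (w1 w2 : {ffun 'I_N.+1 -> {poly R}}) :
  spline_pieces a h p w1 -> spline_pieces a h p w2 ->
  spline_pieces a h p (c *: w1 + w2).
Proof.
move=> [s1 m1 b1] [s2 m2 b2]; split.
- move=> j; rewrite !ffunE (leq_trans (size_polyD _ _))// geq_max s2 andbT.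
  by rewrite (leq_trans (size_scale_leq _ _)).
- move=> j i jN ip; rewrite !ffunE !derivnD !derivnZ !hornerD !hornerZ.
  by rewrite m1// m2.
- move=> l lp; have [x1 y1] := b1 l lp; have [x2 y2] := b2 l lp.
  by rewrite !ffunE !derivnD !derivnZ !hornerD !hornerZ x1 x2 y1 y2 mulr0 addr0.
Qed.

Lemma spline_pieces_cst a h p N c :
  spline_pieces a h p ([ffun=> c%:P] : {ffun 'I_N.+1 -> {poly R}}).
Proof.
have d0 l (x : R) : (c%:P)^`(l.+1).[x] = 0.
  by rewrite derivSn derivC derivn_poly0 ?horner0// size_poly0.
split=> [j|j k _ _|l _]; rewrite ?ffunE ?d0//.
by rewrite (leq_trans (size_polyC_leq1 _)).
Qed.

(** Without terms of degree p, neighbouring pieces have degree below p and the same derivatives of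
    order below p at their common node, so they coincide by Taylor. The single remaining polynomial
    has vanishing odd derivatives at two distinct points, hence is constant, and its value at [a] is
    0. *)
Lemma spline_pieces_eq0 a h p N (w : {ffun 'I_N.+1 -> {poly R}}) :
  0 < h -> spline_pieces a h p w ->
  (forall j, (w j)`_p = 0) -> (w ord0).[a] = 0 -> w = 0.
Proof.
move=> h0 [sw mw bw] wp wa.
have size_w j : (size (w j) <= p)%N.
  apply/leq_sizeP => i; rewrite leq_eqVlt => /predU1P[<-//|pi].
  by move/leq_sizeP : (sw j); apply.
have wE j : (j <= N)%N -> w (inord j) = w ord0.
  elim: j => [_|j IH jN]; first by congr (w _); apply: val_inj; rewrite /= inordK.
  rewrite -IH ?(ltnW jN)//; apply/eqP; rewrite -subr_eq0; apply/eqP.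
  apply: (@poly_eq0_derivn _ _ (a + h * j.+1%:R) p).
    by rewrite (leq_trans (size_polyD _ _))// size_polyN geq_max !size_w.
  by move=> k kp; rewrite derivnB hornerD hornerN mw// subrr.
have wmax : w ord_max = w ord0.
  by rewrite -(wE N)//; congr (w _); apply: val_inj; rewrite /= inordK.
have w0 : w ord0 = 0.
  have /size1_polyC w0E : (size (w ord0) <= 1)%N.
    apply: (@size_poly_le1_odd_derivn _ _ a (a + h * N.+1%:R) p) => //.
    - by rewrite lt_eqF// ltrDl mulr_gt0.
    - by move=> l /bw; rewrite wmax.
  by rewrite w0E; move: wa; rewrite {1}w0E hornerC => ->; rewrite polyC0.
apply/ffunP => j; rewrite ffunE -w0 -(wE j) ?inord_val//.
by rewrite -ltnS.
Qed.

Lemma derive1n_eq_in s t v q k : {in `]s, t[, v =1 horner q} ->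
  {in `]s, t[, (v^`(k))%classic =1 horner q^`(k)}.
Proof.
move=> vq; elim: k => [//|k IH] x xst.
rewrite derive1nS derivnS derivE !derive1E; apply: near_eq_derive.
have := near_in_itvoo xst; apply: filterS => y yst; exact: IH.
Qed.

Lemma horner_eq0_at_right s t (f : R -> R) q : s < t -> {in `]s, t[, f =1 horner q} ->
  f x @[x --> s^'+] --> (0 : R) -> q.[s] = 0.
Proof.
move=> st fq f0; apply: (@cvg_unique _ (@Rhausdorff R) (q.[x] @[x --> s^'+])).
  by apply: cvg_at_right_filter; exact: continuous_horner.
apply: cvg_trans f0; apply: near_eq_cvg; near=> x; rewrite fq// in_itv/=.
apply/andP; split; near: x; first exact: nbhs_right_gt.
exact: nbhs_right_lt.
Unshelve. all: by end_near. Qed.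

Lemma horner_eq0_at_left s t (f : R -> R) q : s < t -> {in `]s, t[, f =1 horner q} ->
  f x @[x --> t^'-] --> (0 : R) -> q.[t] = 0.
Proof.
move=> st fq f0; apply: (@cvg_unique _ (@Rhausdorff R) (q.[x] @[x --> t^'-])).
  by apply: cvg_at_left_filter; exact: continuous_horner.
apply: cvg_trans f0; apply: near_eq_cvg; near=> x; rewrite fq// in_itv/=.
apply/andP; split; near: x; first exact: nbhs_left_gt.
exact: nbhs_left_lt.
Unshelve. all: by end_near. Qed.

Lemma reduced_spline_pieces a h p N v : 0 < h ->
  reduced_spline a (a + h * N.+1%:R) p h v ->
  exists2 w : {ffun 'I_N.+1 -> {poly R}}, spline_pieces a h p w &
    forall j : 'I_N.+1, {in `]a + h * j%:R, a + h * j.+1%:R], v =1 horner (w j)}.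
Proof.
move=> h0 [[vH vpoly] bv].
have hNE : h^-1 * (a + h * N.+1%:R - a) = N.+1%:R.
  by rewrite addrC addKr mulKf// gt_eqF.
rewrite hNE in vpoly.
have qP (j : 'I_N.+1) : exists q, (size q <= p.+1)%N /\
    {in `]a + h * j%:R, a + h * j.+1%:R], v =1 horner q}.
  by have [|q sq vq] := vpoly j; [rewrite ltr_nat | exists q].
have [w0 w0P] := choice qP.
exists [ffun j => w0 j] => [|j x xj]; last by rewrite ffunE (w0P j).2.
have vw (j : nat) x : (j < N.+1)%N -> a + h * j%:R < x <= a + h * j.+1%:R ->
    v x = (w0 (inord j)).[x].
  by move=> jN; have := (w0P (inord j)).2 x; rewrite in_itv/= inordK.
split=> [j|j k jN kp|l lp]; rewrite !ffunE; first exact: (w0P j).1.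
- have jE (i : nat) : a + h * (i.+1)%:R = a + h * i%:R + h.
    by rewrite -natr1 mulrDr mulr1 addrA.
  rewrite jE; apply: (H_pieces_derivn (s := a + h * j%:R) _ _ _ vH) => //.
  + by rewrite lerDl mulr_ge0// ltW.
  + by rewrite -addrA -mulrDr lerD2l ler_pM2l// -natrD ler_nat addn2.
  move=> x; rewrite in_itv/= /glue_poly => /andP[jx xj].
  have [xj'|xj'] := leP x (a + h * j%:R + h).
    by apply: vw; rewrite ?jx ?jE// ltnW.
  apply: vw; rewrite ?jE ?xj'//= ltW//.
  by move: xj; rewrite [h * 2]mulr_natr mulr2n addrA.
(* Inside an end cell the classical derivatives of v are those of its piece, whose continuity turns
   the one-sided limit into a value. *)
- have [va vb] := bv l lp; split.
  + apply: (horner_eq0_at_right (t := a + h) _ _ va); first by rewrite ltrDl.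
    apply: derive1n_eq_in => x; rewrite in_itv/= => /andP[ax xh].
    by have := (w0P ord0).2 x; apply; rewrite in_itv/= mulr0 addr0 mulr1 ax ltW.
  + apply: (horner_eq0_at_left (s := a + h * N%:R) _ _ vb).
      by rewrite ltrD2l ltr_pM2l// ltr_nat.
    apply: derive1n_eq_in => x; rewrite in_itv/= => /andP[ax xh].
    by have := (w0P ord_max).2 x; apply; rewrite in_itv/= ax ltW.
Qed.

End spline_pieces.

(** * Piecewise linear functions *)

Section piecewise_linear.
Context {R : realType}.
Local Notation mu := (@lebesgue_measure R).
Implicit Types (a b h x : R) (s : nat -> R) (phi : R -> R) (i k m : nat).

(** A ramp that climbs with slope 1 on one cell and is constant elsewhere. Coordinates are thus
    slopes rather than nodal values, so the weak derivative is read off directly. *)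
Definition pwl_basis a h i x : R :=
  if i is k.+1 then Num.min h (Num.max 0 (x - (a + h * k%:R))) else 1.

(* [s 0] is the value at [a] and [s k.+1] the slope on the [k]-th cell. *)
Definition pwl a h m s x : R := \sum_(i < m.+1) s i * pwl_basis a h i x.

Definition pwl_slope a h m s x : R :=
  \sum_(k < m) s k.+1 * (a + h * k%:R < x <= a + h * k.+1%:R)%R%:R.

Definition pwl_node h s k : R := s 0%N + h * \sum_(i < k) s i.+1.

Lemma continuous_pwl_basis a h i : continuous (pwl_basis a h i).
Proof.
case: i => [|k] x; first exact: cvg_cst.
apply: continuous2_cvg; [exact: min_continuous (_, _)|exact: cvg_cst|].
apply: continuous2_cvg; [exact: max_continuous (_, _)|exact: cvg_cst|].
by apply: cvgB; [exact: cvg_id|exact: cvg_cst].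
Qed.

Lemma continuous_sum m (f : nat -> R -> R) : (forall i, continuous (f i)) ->
  continuous (fun x => \sum_(i < m) f i x).
Proof.
move=> cf; elim: m => [|k IH] x.
  by under eq_fun do rewrite big_ord0; exact: cvg_cst.
under eq_fun do rewrite big_ord_recr/=.
by apply: cvgD; [exact: IH|exact: cf].
Qed.

Lemma continuous_pwl a h m s : continuous (pwl a h m s).
Proof.
apply: (@continuous_sum m.+1 (fun i x => s i * pwl_basis a h i x)) => i x.
by apply: cvgM; [exact: cvg_cst|exact: continuous_pwl_basis].
Qed.

Lemma grid_le a h i k : 0 < h -> (i <= k)%N -> a + h * i%:R <= a + h * k%:R.
Proof. by move=> h0 ik; rewrite lerD2l ler_pM2l// ler_nat. Qed.

(** On the k-th cell the earlier ramps have saturated at [h] and the later ones are still 0. *)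
Lemma pwlE a h m s k x : 0 < h -> (k < m)%N ->
  a + h * k%:R <= x <= a + h * k.+1%:R ->
  pwl a h m s x = pwl_node h s k + s k.+1 * (x - (a + h * k%:R)).
Proof.
move=> h0 km /andP[kx xk].
rewrite /pwl big_ord_recl/= mulr1 /pwl_node -addrA; congr (_ + _).
transitivity (\sum_(0 <= i < m) s i.+1 * pwl_basis a h i.+1 x).
  by rewrite big_mkord.
have rest0 : \sum_(k.+1 <= i < m) s i.+1 * pwl_basis a h i.+1 x = 0.
  rewrite big_nat_cond big1// => i /andP[/andP[ki _] _]; have ti := grid_le a h0 ki.
  by rewrite /= max_l ?subr_le0 ?(le_trans xk)// min_r ?mulr0// ltW.
rewrite (@big_cat_nat _ _ _ k.+1)//= rest0 addr0.
rewrite big_nat_recr//= big_mkord mulr_sumr; congr (_ + _).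
  apply: eq_bigr => i _; rewrite mulrC; congr (_ * _).
  have := grid_le a h0 (ltn_ord i); rewrite -natr1 mulrDr mulr1 addrA => ti.
  have hx : h <= x - (a + h * i%:R) by rewrite lerBrDl (le_trans ti).
  by rewrite max_r ?min_l// (le_trans _ hx)// ltW.
rewrite max_r ?subr_ge0// min_r//.
by rewrite lerBlDr (le_trans xk)// -natr1 mulrDr mulr1 [leRHS]addrC addrA.
Qed.

Lemma pwl_slopeE a h m s k x : 0 < h -> (k < m)%N ->
  a + h * k%:R < x <= a + h * k.+1%:R -> pwl_slope a h m s x = s k.+1.
Proof.
move=> h0 km kx; rewrite /pwl_slope (bigD1 (Ordinal km))//= kx mulr1.
rewrite big1 ?addr0// => i; rewrite -val_eqE/= neq_ltn => ik.
case: (andP kx) => kx1 kx2.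
rewrite [X in (nat_of_bool X)%:R](_ : _ = false) ?mulr0//; apply/negP => /andP[ix xi].
case/orP : ik => ik.
  have := grid_le a h0 ik; lra.
have := grid_le a h0 ik; lra.
Qed.

Lemma pwl_slope_pw a h m s : 0 < h -> pw_continuous a h m (pwl_slope a h m s).
Proof.
move=> h0 k km; exists (cst (s k.+1)); first by move=> x; exact: cvg_cst.
by move=> x; rewrite in_itv/= => /(pwl_slopeE s h0 km).
Qed.

Lemma pwl_nodeS h s k : pwl_node h s k.+1 = pwl_node h s k + s k.+1 * h.
Proof. by rewrite /pwl_node big_ord_recr/= mulrDr addrA [s _ * h]mulrC. Qed.

Lemma grid_lt a h k : 0 < h -> a + h * k%:R < a + h * k.+1%:R.
Proof. by move=> h0; rewrite ltrD2l ltr_pM2l// ltr_nat. Qed.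

(** On each cell the integrand is the derivative of an affine function times phi. Neighbouring
    affine functions agree at their node, so the sum telescopes, and phi vanishes at both ends. *)
Lemma weak_derivative_pwl a h m s : 0 < h ->
  is_weak_derivative a (a + h * m%:R) 1 (pwl a h m s) (pwl_slope a h m s).
Proof.
move=> h0.
have pu : pw_continuous a h m (pwl a h m s) by apply: continuous_pw; exact: continuous_pwl.
have pg := @pwl_slope_pw a h m s h0.
split; [exact: pw_locally_integrable|exact: pw_locally_integrable|].
move=> phi tphi.
have c0 : continuous phi := @test_function_continuous _ _ _ _ 0 tphi.
have c1 : continuous (phi^`(1))%classic := @test_function_continuous _ _ _ _ 1 tphi.
have p0 : pw_continuous a h m phi by exact: continuous_pw.
have p1 : pw_continuous a h m (phi^`(1))%classic by exact: continuous_pw.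
rewrite expr1 mulN1r; apply/eqP; rewrite -addr_eq0 -RintegralD//; last 2 first.
- by apply: pw_integrable_oo => //; exact: pw_continuousM.
- by apply: pw_integrable_oo => //; exact: pw_continuousM.
rewrite pw_Rintegral_oo//; last by apply: pw_continuousD; exact: pw_continuousM.
pose U k := pwl_node h s k * phi (a + h * k%:R).
transitivity (\sum_(0 <= k < m) (U k.+1 - U k) == 0); last first.
  rewrite telescope_sumr// /U mulr0 addr0.
  rewrite !(test_function_eq0 tphi) ?in_itv/= ?ltxx ?andbF//.
  by rewrite !mulr0 subrr eqxx.
rewrite big_mkord; congr (_ == _); apply: eq_bigr => k _.
pose l x := pwl_node h s k + s k.+1 * (x - (a + h * k%:R)).
have dl (x : R) : is_derive x 1 l (s k.+1).
  have d1 : is_derive x 1 (fun y => y - (a + h * k%:R)) (1 - 0) by exact: is_deriveB.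
  have d2 := is_deriveD (is_derive_cst (pwl_node h s k) x 1) (is_deriveZ (s k.+1) d1).
  by apply: (is_derive_eq d2); rewrite /GRing.scale/= subr0 mulr1 add0r.
have cl : continuous l.
  move=> x; apply: differentiable_continuous; apply/derivable1_diffP.
  by case: (dl x).
pose g x := l x * (phi^`(1))%classic x + s k.+1 * phi x.
have cg : continuous g.
  by move=> x; apply: cvgD; apply: cvgM; [exact: cl|exact: c1|exact: cvg_cst|exact: c0].
have dG (x : R) : is_derive x 1 (fun y => l y * phi y) (g x).
  have d3 := is_deriveM (dl x) (test_function_is_derive 0 x tphi).
  by apply: (is_derive_eq d3); rewrite /GRing.scale/= [X in _ + X]mulrC.
rewrite (cell_FTC _ cg dG); last first.
- move=> x; rewrite in_itv/= => xk; rewrite (pwl_slopeE s h0 (ltn_ord k) xk).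
  by case/andP : xk => /ltW xk1 xk2; rewrite (pwlE s h0 (ltn_ord k)) ?xk1.
- exact: grid_lt.
rewrite /U /l subrr mulr0 addr0; congr (_ * _ - _).
by rewrite pwl_nodeS; congr (_ + _ * _); rewrite -natr1; ring.
Qed.

Lemma pwl_slope_norm a h m s : 0 < h ->
  \int[mu]_(x in `]a, a + h * m%:R[) (pwl_slope a h m s x ^+ 2) =
  \sum_(k < m) h * s k.+1 ^+ 2.
Proof.
move=> h0; have pg := @pwl_slope_pw a h m s h0.
rewrite pw_Rintegral_oo//; last exact: pw_continuousM.
apply: eq_bigr => k _.
have dG (x : R) : is_derive x 1 (horner (s k.+1 ^+ 2 *: 'X)) (cst (s k.+1 ^+ 2) x).
  by apply: (is_derive_eq (is_derive_poly _ x)); rewrite derivZ derivX !hornerE.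
rewrite (cell_FTC _ _ dG); last first.
- by move=> x; rewrite in_itv/= => xk; rewrite (pwl_slopeE s h0 (ltn_ord k) xk).
- by move=> x; exact: cvg_cst.
- exact: grid_lt.
by rewrite !hornerZ !hornerX -natr1; ring.
Qed.

Lemma pwl_inverse_inequality a h m s : 0 < h ->
  h ^+ 2 / 12 * (\sum_(k < m) h * s k.+1 ^+ 2) <=
  \int[mu]_(x in `]a, a + h * m%:R[) (pwl a h m s x ^+ 2).
Proof.
move=> h0.
have pu : pw_continuous a h m (pwl a h m s) by apply: continuous_pw; exact: continuous_pwl.
rewrite pw_Rintegral_oo//; last exact: pw_continuousM.
rewrite mulr_sumr; apply: ler_sum => k _.
set c := pwl_node h s k; set e := s k.+1; set t := a + h * k%:R.
pose Y : {poly R} := 'X - t%:P.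
pose G := c ^+ 2 *: Y + (c * e) *: Y ^+ 2 + (e ^+ 2 / 3) *: Y ^+ 3.
have cg : continuous (fun x => (c + e * (x - t)) ^+ 2).
  have cl : continuous (fun x => c + e * (x - t)).
    move=> x; apply: cvgD; first exact: cvg_cst.
    by apply: cvgM; [exact: cvg_cst|apply: cvgB; [exact: cvg_id|exact: cvg_cst]].
  by move=> x; exact: cvgM (cl x) (cl x).
have dG (x : R) : is_derive x 1 (horner G) ((c + e * (x - t)) ^+ 2).
  apply: (is_derive_eq (is_derive_poly _ x)).
  by rewrite /G /Y !poly.derivE !hornerE/=; field.
rewrite (cell_FTC _ cg dG); last first.
- move=> x; rewrite in_itv/= => /andP[/ltW xk1 xk2].
  by rewrite (pwlE s h0 (ltn_ord k)) ?xk1.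
- exact: grid_lt.
have -> : a + h * k.+1%:R = t + h by rewrite /t -natr1 mulrDr mulr1 addrA.
rewrite /G /Y !(hornerXsubC, hornerD, hornerZ, horner_exp) [t + h]addrC addrK subrr.
(* The affine function splits into its midpoint value and an orthogonal part of mean zero. The
   latter has squared norm e^2 h^3 / 12, and the surplus is the contribution of the midpoint
   value. *)
rewrite -subr_ge0 [X in 0 <= X](_ : _ = h * (c + e * h / 2) ^+ 2); last by field.
by rewrite mulr_ge0 ?sqr_ge0// ltW.
Qed.

End piecewise_linear.

(** * Orthogonality and the H^1 seminorm *)

Section orthogonal_pwl.
Context {R : realType}.
Local Notation mu := (@lebesgue_measure R).
Implicit Types (a b h x : R) (s : nat -> R) (u v w f g : R -> R) (i k m r : nat).

Lemma Rintegral_oc_sum (a b : R) m (c : nat -> R) (f : nat -> R -> R) :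
  (forall i, continuous (f i)) ->
  \int[mu]_(x in `]a, b]) (\sum_(i < m) c i * f i x) =
  \sum_(i < m) c i * \int[mu]_(x in `]a, b]) f i x.
Proof.
move=> cf; have ccf i : continuous (fun x => c i * f i x).
  by move=> x; apply: cvgM; [exact: cvg_cst|exact: cf].
elim: m => [|m IH].
  under eq_Rintegral do rewrite big_ord0.
  by rewrite big_ord0 Rintegral_cst// mul0r.
under eq_Rintegral do rewrite big_ord_recr/=.
rewrite big_ord_recr/= RintegralD//; last 2 first.
- by apply: continuous_integrable_oc; exact: (@continuous_sum _ m (fun i x => c i * f i x)).
- exact: continuous_integrable_oc.
by rewrite IH RintegralZl//; exact: continuous_integrable_oc.
Qed.

Section moments.
Variables (a h : R) (p N m : nat).

(** The L2 products of the P1 basis of mesh [h / 2] with the spline whose pieces are w, taken over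
    the cells of length [h]. *)
Definition pwl_moments (w : {ffun 'I_N.+1 -> {poly R}}) : 'rV[R]_m.+1 :=
  \row_i \sum_(j < N.+1) \int[mu]_(x in `]a + h * j%:R, a + h * j.+1%:R])
    (pwl_basis a (h / 2) i x * (w j).[x]).

Lemma pwl_moments_linear : linear pwl_moments.
Proof.
move=> c w1 w2; apply/rowP => i; rewrite !mxE mulr_sumr -big_split/=.
apply: eq_bigr => j _.
have cbw (w : {ffun 'I_N.+1 -> {poly R}}) :
    mu.-integrable `]a + h * j%:R, a + h * j.+1%:R]
      (EFin \o (fun x => pwl_basis a (h / 2) i x * (w j).[x])).
  apply: continuous_integrable_oc => x; apply: cvgM.
    exact: continuous_pwl_basis.
  exact: continuous_horner.
rewrite -RintegralZl// -RintegralD//; last first.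
  apply: eq_integrable (integrableZl _ _ (cbw w1)) => //.
by apply: eq_Rintegral => x _; rewrite !ffunE hornerD hornerZ; ring.
Qed.

HB.instance Definition _ :=
  GRing.isLinear.Build R _ _ _ pwl_moments pwl_moments_linear.

(** The p-th coefficients stand for the piecewise constant p-th derivative, up to the factor p!.
    With the value at [a] they make N+2 = n+1 coordinates. *)
Definition spline_coords (w : {ffun 'I_N.+1 -> {poly R}}) : 'rV[R]_N.+2 :=
  \row_i if unlift ord0 i is Some j then (w j)`_p else (w ord0).[a].

Lemma spline_coords_linear : linear spline_coords.
Proof.
move=> c w1 w2; apply/rowP => i; rewrite !mxE; case: unliftP => [j|] _.
  by rewrite !ffunE coefD coefZ.
by rewrite !ffunE hornerD hornerZ.
Qed.

HB.instance Definition _ :=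
  GRing.isLinear.Build R _ _ _ spline_coords spline_coords_linear.

End moments.

Lemma exists_orthogonal_pwl a h p N : 0 < h ->
  exists s, (exists2 k, (k < N.+1.*2)%N & s k.+1 != 0) /\
    forall w : {ffun 'I_N.+1 -> {poly R}}, spline_pieces a h p w ->
      \sum_(j < N.+1) \int[mu]_(x in `]a + h * j%:R, a + h * j.+1%:R])
        (pwl a (h / 2) N.+1.*2 s x * (w j).[x]) = 0.
Proof.
move=> h0.
have [||||c c0 cB] := @exists_orthogonal R _ (@spline_pieces R a h p N) N.+2 N.+1.*2.+1
    (spline_coords a p (N:=N)) (pwl_moments a h (N:=N) N.+1.*2).
- by rewrite doubleS; lia.
- rewrite (_ : 0 = [ffun=> 0%:P]); first exact: spline_pieces_cst.
  by apply/ffunP => j; rewrite !ffunE.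
- by move=> k w1 w2; exact: spline_pieces_linear.
- move=> w sw /rowP w0; apply: spline_pieces_eq0 sw _ _ => //.
    by move=> j; have := w0 (lift ord0 j); rewrite !mxE liftK.
  by have := w0 ord0; rewrite !mxE unlift_none.
pose s i := if insub i is Some j then c j 0 else 0.
have sE (i : 'I_N.+1.*2.+1) : s i = c i 0 by rewrite /s valK.
have orth (w : {ffun 'I_N.+1 -> {poly R}}) : spline_pieces a h p w ->
      \sum_(j < N.+1) \int[mu]_(x in `]a + h * j%:R, a + h * j.+1%:R])
        (pwl a (h / 2) N.+1.*2 s x * (w j).[x]) = 0.
  move=> /cB /matrixP /(_ 0 0); rewrite !mxE => B0; rewrite -[RHS]B0.
  under [RHS]eq_bigr do rewrite mxE mulr_suml.
  rewrite exchange_big/=; apply: eq_bigr => j _.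
  under eq_Rintegral do rewrite mulr_suml.
  under eq_Rintegral do under eq_bigr do rewrite -mulrA.
  rewrite (@Rintegral_oc_sum _ _ _ s (fun i x => pwl_basis a (h / 2) i x * (w j).[x])).
    by apply: eq_bigr => i _; rewrite sE mulrC.
  move=> i x; apply: cvgM; first exact: continuous_pwl_basis.
  exact: continuous_horner.
exists s; split => //.
(* If all slopes vanished, u would be the constant [s 0]. Orthogonality to the constant spline 1
   would then give [s 0 = 0], hence c = 0. *)
apply: contrapT => s0.
have {}s0 k : (k < N.+1.*2)%N -> s k.+1 = 0.
  by move=> km; apply/eqP/negPn/negP => sk; apply: s0; exists k.
have uE : pwl a (h / 2) N.+1.*2 s = cst (s 0%N).
  apply/funext => x; rewrite /pwl big_ord_recl mulr1 big1 ?addr0// => i _.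
  by rewrite s0 ?mul0r.
have := orth _ (spline_pieces_cst a h p N 1).
rewrite uE (eq_bigr (fun=> s 0%N * h)) => [|j _].
  rewrite sumr_const card_ord -mulr_natr => /eqP.
  rewrite !mulf_eq0 (gt_eqF h0) pnatr_eq0 !orbF => /eqP s00.
  move/negP : c0; apply; apply/eqP/matrixP => i z; rewrite ord1 mxE -sE.
  by case: i => -[|i] /= im; [exact: s00|exact: s0].
have dG (x : R) : is_derive x 1 (horner (s 0%N *: 'X)) (cst (s 0%N) x).
  by apply: (is_derive_eq (is_derive_poly _ x)); rewrite derivZ derivX !hornerE.
rewrite (cell_FTC _ _ dG); last first.
- by move=> x _; rewrite ffunE hornerC mulr1.
- by move=> x; exact: cvg_cst.
- exact: grid_lt.
by rewrite !hornerZ !hornerX -natr1; ring.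
Qed.

Lemma L2_norm_ae_eq a b f g :
  measurable_fun `]a, b[ f -> measurable_fun `]a, b[ g ->
  {ae mu, forall x, x \in `]a, b[ -> f x = g x} -> L2_norm a b f = L2_norm a b g.
Proof.
move=> mf mg fg; rewrite /L2_norm unlock; congr (_ `^ _)%E.
have mpow (k : R -> R) : measurable_fun `]a, b[ k ->
    measurable_fun setT (fun x : R => `|(EFin \o (k \_ `]a, b[)) x| `^ 2)%E.
  move=> mk; apply: measurableT_comp (measurable_poweR 2) _.
  apply: measurableT_comp => //; apply/measurable_EFinP.
  exact/(measurable_restrictT _ _).1.
apply: ae_eq_integral => //; [exact: mpow|exact: mpow|].
apply: (@filterS _ _ (ae_filter_ringOfSetsType mu)) fg => x fg _.
by rewrite /= !patchE; case: ifPn => //; rewrite inE/= => /fg ->.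
Qed.

(** [weak_derivative] is a chosen witness, so it can be replaced by g only up to a null set; du
    Bois-Reymond applied to the difference shows that this is enough for the norm. *)
Lemma H_seminormE a b r u g : is_weak_derivative a b r u g ->
  H_seminorm a b r u = L2_norm a b g.
Proof.
move=> ug.
have : is_weak_derivative a b r u (weak_derivative a b r u).
  by rewrite /weak_derivative; apply: (getPex (ex_intro _ g ug)).
rewrite /H_seminorm; set w := weak_derivative a b r u => -[_ lw uw].
have [_ lg ug'] := ug.
have [mw _ _] := lw; have [mg _ _] := lg.
apply: L2_norm_ae_eq => //.
have : {ae mu, forall x, x \in `]a, b[ -> (w \- g) x = 0}.
  apply: du_bois_reymond; first exact: locally_integrableB.
  move=> phi tphi; under eq_Rintegral do rewrite /= mulrBl.
  rewrite RintegralB//; [|exact: integrableM_test_function..].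
  have := uw _ tphi; rewrite (ug' _ tphi) => /mulfI ->; rewrite ?subrr//.
  by rewrite expf_neq0// oppr_eq0 oner_eq0.
apply: (@filterS _ _ (ae_filter_ringOfSetsType mu)) => x wg xab.
by apply/eqP; rewrite -subr_eq0; apply/eqP; exact: wg.
Qed.

End orthogonal_pwl.

(** * Membership in H^1, Pythagoras and the final estimate *)

Lemma pwl_in_H1 (R : realType) (a h : R) m s : 0 < h ->
  in_H a (a + h * m%:R) 1 (pwl a h m s).
Proof.
move=> h0; have pu : pw_continuous a h m (pwl a h m s).
  by apply: continuous_pw; exact: continuous_pwl.
split=> [|[_|[_|//]]]; first exact: pw_in_L2.
- exists (pwl a h m s); last exact: pw_in_L2.
  by split=> [||phi _]; rewrite ?mul1r//; exact: pw_locally_integrable.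
- exists (pwl_slope a h m s); first exact: weak_derivative_pwl.
  by apply: pw_in_L2 => //; exact: pwl_slope_pw.
Qed.

(* Apply the inverse inequality to [u - C], which is again piecewise linear with
   the slopes of [u]. *)
Lemma pwl_not_ae_constant (R : realType) (a h : R) m k s : 0 < h ->
  (k < m)%N -> s k.+1 != 0 -> ~ ae_constant a (a + h * m%:R) (pwl a h m s).
Proof.
move=> h0 km sk [C uC].
pose s' i := if i is j.+1 then s j.+1 else s 0%N - C.
have s'E x : pwl a h m s' x = pwl a h m s x - C.
  rewrite /pwl !big_ord_recl/= !mulr1 addrAC; congr (_ + _ + _).
have := pwl_inverse_inequality a m s' h0; rewrite Rintegral_ae_eq0.
- apply/negP; rewrite -ltNge mulr_gt0 ?divr_gt0 ?exprn_gt0//.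
  rewrite (bigD1 (Ordinal km))//= ltr_wpDr//.
    by apply: sumr_ge0 => i _; rewrite mulr_ge0 ?sqr_ge0// ltW.
  by rewrite mulr_gt0// exprn_even_gt0.
- apply: measurable_funTS; apply: continuous_measurable_fun => x.
  by have cs := @continuous_pwl R a h m s' x; exact: (cvgM cs cs).
- apply: (@filterS _ _ (ae_filter_ringOfSetsType _)) uC => x uC xab.
  by rewrite s'E uC// subrr expr0n.
Qed.

Lemma ler_Rintegral_sqrB (R : realType) (a h : R) m (u v : R -> R) : 0 < h ->
  pw_continuous a h m u -> pw_continuous a h m v ->
  \int[lebesgue_measure]_(x in `]a, a + h * m%:R[) (u x * v x) = 0 ->
  \int[lebesgue_measure]_(x in `]a, a + h * m%:R[) (u x ^+ 2) <=
  \int[lebesgue_measure]_(x in `]a, a + h * m%:R[) ((u x - v x) ^+ 2).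
Proof.
move=> h0 pu pv uv0.
have puu := pw_continuousM pu pu; have pvv := pw_continuousM pv pv.
have puv := pw_continuousM pu pv.
have i1 := pw_integrable_oo h0 puu; have i2 := pw_integrable_oo h0 pvv.
have i3 := pw_integrable_oo h0 puv.
have i4 : lebesgue_measure.-integrable `]a, a + h * m%:R[
    (EFin \o (fun x => - 2 * (u x * v x))).
  by apply: eq_integrable (integrableZl _ (- 2) i3).
have sqrE x : (u x - v x) ^+ 2 = u x * u x + (v x * v x + - 2 * (u x * v x)).
  by ring.
under [leRHS]eq_Rintegral do rewrite sqrE.
rewrite RintegralD//; last first.
  by apply: eq_integrable (integrableD _ i2 i4).
rewrite lerDl RintegralD// RintegralZl// uv0 mulr0 addr0.
by apply: Rintegral_ge0 => x _; exact: sqr_ge0.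
Qed.

Theorem corollary2 (R : realType) (a b : R) (hab : a < b)
    (h : R) (hh : grid_size a b h) (p : nat) (hp : (0 < p)%N) :
  exists u : R -> R,
    [/\ in_H a b 1 u,
        ~ ae_constant a b u &
        ((1 / (4 * Num.sqrt 3) * h)%:E * H_seminorm a b 1 u <=
         ereal_inf [set L2_norm a b (fun x => (u x - v x)%R) |
                    v in [set v : R -> R | reduced_spline a b p h v]])%E].
Proof.
case: hh => h0 [[//|N] _ hN].
have {hab hN} -> : b = a + h * N.+1%:R.
  by rewrite -hN mulrA divff ?mul1r ?gt_eqF// addrC subrK.
have [s [[k km sk] orth]] := exists_orthogonal_pwl a p N h0.
have h20 : 0 < h / 2 by rewrite divr_gt0.
(* The same interval is read as n cells of length h for the splines and as 2n cells of length h/2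
   for u. *)
have bE : a + h * N.+1%:R = a + h / 2 * (N.+1.*2)%:R.
  by rewrite -mul2n natrM mulrA divfK.
pose m := N.+1.*2; pose u := pwl a (h / 2) m s.
have wu : is_weak_derivative a (a + h * N.+1%:R) 1 u (pwl_slope a (h / 2) m s).
  by rewrite bE; exact: weak_derivative_pwl.
exists u; split.
- by rewrite bE; exact: pwl_in_H1.
- by rewrite bE; exact: pwl_not_ae_constant sk.
rewrite (H_seminormE wu); apply: le_ereal_inf_tmp => _ [v vS <-].
have [w sw vw] := reduced_spline_pieces h0 vS.
have pu : pw_continuous a h N.+1 u by apply: continuous_pw; exact: continuous_pwl.
have pv : pw_continuous a h N.+1 v.
  move=> j jN; exists (horner (w (Ordinal jN))); first exact: continuous_horner.
  exact: vw (Ordinal jN).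
have uv0 : \int[lebesgue_measure]_(x in `]a, a + h * N.+1%:R[) (u x * v x) = 0.
  rewrite pw_Rintegral_oo//; last exact: pw_continuousM.
  rewrite -[RHS](orth w sw); apply: eq_bigr => j _; apply: eq_Rintegral => x.
  by rewrite inE/= => xj; rewrite (vw j).
have puv : pw_continuous a h N.+1 (fun x => u x - v x).
  by apply: pw_continuousD => //; exact: pw_continuousN.
rewrite !L2_normE; last 2 first.
- by apply: pw_integrable_oo => //; exact: pw_continuousM.
- rewrite bE; apply: pw_integrable_oo => //.
  by apply: pw_continuousM; exact: pwl_slope_pw.
rewrite -EFinM lee_fin.
have h_ge0 : 0 <= 1 / (4 * Num.sqrt 3) * h.
  by rewrite mulr_ge0 ?divr_ge0 ?mulr_ge0 ?sqrtr_ge0// ltW.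
rewrite -[X in X * _]ger0_norm// -sqrtr_sqr -sqrtrM ?sqr_ge0// ler_wsqrtr//.
apply: le_trans (ler_Rintegral_sqrB h0 pu pv uv0).
rewrite bE pwl_slope_norm//.
apply: le_trans (pwl_inverse_inequality a m s h20).
(* The constants agree exactly: (h / (4 sqrt 3))^2 = (h/2)^2 / 12 = h^2 / 48. *)
rewrite le_eqVlt; apply/orP; left; apply/eqP; congr (_ * _).
by rewrite !exprMn exprVn exprMn sqr_sqrtr//; field.
Qed.
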